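(* For every integer $n\ge1$ and every abelian group $A$ there is a minimal Eilenberg-Mac Lane space $H(A,n)$ in dimension $n$ for $A$. It is unique up to isomorphism.
   Context: For a pointed Kan complex $(K,\star)$ (a simplicial set satisfying the horn filling condition, with base point $\star\in K_0$, whose degenerate images are also denoted $\star$), write $\partial x=(d_0x,\dots,d_nx)$ for $x\in K_n$; a tuple is ''filled'' if it equals $\partial x$ for some $x$. Two $n$-simplices with $\partial x=\partial y$ (vacuous if $n=0$) are homotopic, $x\sim y$, if $(s_{n-1}d_0x,\dots,s_{n-1}d_{n-1}x,x,y)$ is filled. $\pi_n(K,\star)=\{x\in K_n:\partial x=(\star,\dots,\star)\}/\!\sim$, with group structure for $n\ge1$ given by $[x][y]=[xy]$ whenever $(\star,\dots,\star,y,xy,x)$ is filled. A Kan complex $K$ is minimal if for all $k$ and all $x,y\in K_k$ with $\partial x=\partial y$, $x\sim y$ implies $x=y$. An Eilenberg-Mac Lane space in dimension $n$ for an abelian group $A$ is a pointed Kan complex $(K,\star)$ with $\pi_n(K,\star)\cong A$ and $\pi_k(K,\star)$ trivial for all $k\ge0$, $k\ne n$. *)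

(* Defs.v *)
From mathcomp Require Import all_boot all_order all_algebra.
From mathcomp Require Import boolp classical_sets.
From mathcomp Require Import zify.

Set Implicit Arguments.
Unset Strict Implicit.
Unset Printing Implicit Defensive.

(* The simplicial identities are written with nat indices; [inord i] is the
   ordinal of value [i], and every index occurring below is in range. *)
Record sset := SSet {
  simplex :> nat -> Type;
  face : forall n, 'I_n.+2 -> simplex n.+1 -> simplex n;
  degen : forall n, 'I_n.+1 -> simplex n -> simplex n.+1;
  face_face : forall n (i j : nat) (x : simplex n.+2), i < j <= n.+2 ->
    face (inord i) (face (inord j) x) = face (inord j.-1) (face (inord i) x);
  degen_degen : forall n (i j : nat) (x : simplex n), i <= j <= n ->
    degen (inord i) (degen (inord j) x) = degen (inord j.+1) (degen (inord i) x);
  face_degen_lt : forall n (i j : nat) (x : simplex n.+1), i < j <= n.+1 ->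
    face (inord i) (degen (inord j) x) = degen (inord j.-1) (face (inord i) x);
  face_degen_id : forall n (j : nat) (x : simplex n), j <= n ->
    face (inord j) (degen (inord j) x) = x;
  face_degen_idS : forall n (j : nat) (x : simplex n), j <= n ->
    face (inord j.+1) (degen (inord j) x) = x;
  face_degen_gt : forall n (i j : nat) (x : simplex n.+1), j.+1 < i <= n.+2 ->
    face (inord i) (degen (inord j) x) = degen (inord j) (face (inord i.-1) x)
}.

Section Sset.
Variable K : sset.

Definition filled n (t : 'I_n.+2 -> K n) : Prop :=
  exists w : K n.+1, forall i, face i w = t i.

Definition same_boundary n : K n -> K n -> Prop :=
  match n with
  | 0 => fun _ _ => True
  | m.+1 => fun x y => forall i : 'I_m.+2, face i x = face i y
  end.

(* The simplex s_(n-1) d_i x, for i < n; there is no such i when n = 0. *)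
Definition degen_face n (i : nat) : K n -> K n :=
  match n with
  | 0 => fun x => x
  | m.+1 => fun x => degen ord_max (face (inord i) x)
  end.

Definition homotopy_tuple n (x y : K n) (i : 'I_n.+2) : K n :=
  if i < n then degen_face i x else if i == n :> nat then x else y.

Definition homotopic n (x y : K n) : Prop :=
  same_boundary x y /\ filled (homotopy_tuple x y).

(* Compatibility of the faces t_i, i <> k, of a k-th horn; vacuous for n = 0. *)
Definition horn n (k : 'I_n.+2) : ('I_n.+2 -> K n) -> Prop :=
  match n return 'I_n.+2 -> ('I_n.+2 -> K n) -> Prop with
  | 0 => fun _ _ => True
  | m.+1 => fun k t => forall i j : 'I_m.+3, i < j -> i != k -> j != k ->
      face (inord i) (t j) = face (inord j.-1) (t i)
  end k.

Definition kan : Prop :=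
  forall n (k : 'I_n.+2) (t : 'I_n.+2 -> K n), horn k t ->
    exists w : K n.+1, forall i, i != k -> face i w = t i.

Definition minimal : Prop :=
  forall k (x y : K k), same_boundary x y -> homotopic x y -> x = y.

End Sset.

Record pkan := PKan {
  pkan_sset :> sset;
  pkan_pt : pkan_sset 0;
  pkanP : kan pkan_sset
}.

Section HomotopyGroups.
Variable K : pkan.

Fixpoint base n : K n :=
  match n with
  | 0 => pkan_pt K
  | m.+1 => degen ord0 (base m)
  end.

Definition is_sphere n : K n -> Prop :=
  match n with
  | 0 => fun _ => True
  | m.+1 => fun x => forall i : 'I_m.+2, face i x = base m
  end.

Definition sphere n := {x : K n | is_sphere x}.

Lemma degen_base n (i : 'I_n.+1) : degen i (base n) = base n.+1.
Proof.
elim: n i => [|n IHn] i; first by rewrite (ord1 i).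
case: (posnP i) => [i0|i_gt0].
  by congr (degen _ _); apply: val_inj.
rewrite -(inord_val i) /=.
have := @degen_degen K n 0 i.-1 (base n); rewrite prednK //.
have -> : inord 0 = ord0 :> 'I_n.+1 by apply: val_inj; rewrite /= inordK.
have -> : inord 0 = ord0 :> 'I_n.+2 by apply: val_inj; rewrite /= inordK.
have := ltn_ord i; move=> hi /(_ _) <-; last by lia.
by rewrite IHn.
Qed.

Lemma face_base n (i : 'I_n.+2) : face i (base n.+1) = base n.
Proof.
have := ltn_ord i; rewrite -{2}(inord_val i) => hi.
case: (ltnP i n.+1) => hin.
  by rewrite -(degen_base (inord i)) face_degen_id.
rewrite -(degen_base (inord n)).
have -> : (i : nat) = n.+1 by lia.
by rewrite face_degen_idS.
Qed.

Lemma base_is_sphere n : is_sphere (base n).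
Proof. by case: n => // n i; apply: face_base. Qed.

Definition sphere_base n : sphere n := exist _ (base n) (base_is_sphere n).

Local Open Scope classical_set_scope.

Definition hclass n (x : sphere n) : set (sphere n) :=
  [set y | homotopic (sval x) (sval y)].

(* The underlying set of pi_n: the quotient, as the type of homotopy classes. *)
Definition pi n := {C : set (sphere n) | exists x, C = hclass x}.

Definition pi_class n (x : sphere n) : pi n :=
  exist _ (hclass x) (ex_intro _ x erefl).

Definition pi_base n : pi n := pi_class (sphere_base n).

(* The tuple (base, ..., base, y, z, x); meaningful for n > 0. *)
Definition mul_tuple n (x y z : K n) (i : 'I_n.+2) : K n :=
  if i.+1 < n then base n
  else if i.+1 == n then y
  else if i == n :> nat then z
  else x.

Definition is_product n (a b c : pi n) : Prop :=
  exists x y z : sphere n,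
    [/\ a = pi_class x, b = pi_class y, c = pi_class z
      & filled (mul_tuple (sval x) (sval y) (sval z))].

(* For n > 0 the product exists and is unique: see [pi_mulE]. *)
Definition pi_mul n (a b : pi n) : pi n :=
  match pselect (exists c, is_product a b c) with
  | left h => sval (cid h)
  | right _ => pi_base n
  end.

Local Close Scope classical_set_scope.

(* If the rows t_j, j <> k, of a matrix with the symmetry of the faces of faces
   of a simplex are filled, then so is the row t_k. *)
Lemma fill_matrix m (t : nat -> nat -> K m.+1) k :
  (forall i j, i < j <= m.+3 -> t j i = t i j.-1) -> k <= m.+3 ->
  (forall j, j <= m.+3 -> j != k -> filled (fun i : 'I_m.+3 => t j i)) ->
  filled (fun i : 'I_m.+3 => t k i).
Proof.
move=> tC hk fill_t.
have /choice[w wP] (j : 'I_m.+4) : exists v : K m.+2, j != k :> nat ->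
    forall i : 'I_m.+3, face i v = t j i.
  case: (eqVneq (j : nat) k) => [_|jk]; first by exists (base m.+2).
  have [|v vP] := fill_t j _ jk; first by have := ltn_ord j; lia.
  by exists v.
have [|W WP] := @pkanP K m.+2 (inord k) w.
  move=> i j ij ik jk.
  have hi := ltn_ord i; have hj := ltn_ord j.
  have neq (l : 'I_m.+4) : l != inord k -> l != k :> nat.
    by apply: contra => /eqP lk; apply/eqP/val_inj; rewrite /= inordK.
  rewrite !wP ?neq // !inordK; [|lia|lia].
  by apply: tC; lia.
have Wi i : i <= m.+3 -> i != k -> face (inord i) W = w (inord i).
  move=> hi ik; apply: WP; apply: contra ik => /eqP /(congr1 val) /=.
  by rewrite !inordK // => ->.
exists (face (inord k) W) => i; have hi := ltn_ord i.
rewrite -[X in face X _](inord_val i).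
case: (ltnP i k) => ik.
  rewrite face_face; last by lia.
  rewrite Wi; [|lia|lia].
  rewrite wP ?inordK; [|lia..].
  by rewrite -tC //; lia.
have := @face_face K _ k i.+1 W => /= <-; last by lia.
rewrite Wi; [|lia|lia].
rewrite wP ?inordK; [|lia..].
by rewrite tC //; lia.
Qed.

(* The tuple (base, ..., base, a, b, c) is filled. *)
Definition fill3 m (a b c : K m.+1) := filled (mul_tuple c a b).

Lemma fill3P m (t : nat -> K m.+1) (a b c : K m.+1) :
  (forall i, i < m -> t i = base m.+1) -> t m = a -> t m.+1 = b -> t m.+2 = c ->
  (fun i : 'I_m.+3 => t i) = mul_tuple c a b.
Proof.
move=> t0 ta tb tc; apply/funext => i; have hi := ltn_ord i.
rewrite /mul_tuple; case: ifP => h1; first by rewrite t0 //; lia.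
case: ifP => [/eqP h2|h2]; first by rewrite -ta; congr t; lia.
case: ifP => [/eqP ->//|h3].
by rewrite -tc; congr t; lia.
Qed.

(* If three of the four tuples are filled, then so is the fourth. *)
Lemma fill4 m (A B C D E F : K m.+1) l : l < 4 ->
  let T k := nth (fill3 A B C) [:: fill3 A B C; fill3 A D E; fill3 B D F;
                                   fill3 C E F] k in
  (forall k, k < 4 -> k != l -> T k) -> T l.
Proof.
move=> l4 T TP.
pose r k : K m.+1 * K m.+1 * K m.+1 :=
  nth (A, B, C) [:: (A, B, C); (A, D, E); (B, D, F); (C, E, F)] k.
pose row (p : K m.+1 * K m.+1 * K m.+1) i : K m.+1 :=
  if i < m then base m.+1 else if i == m then p.1.1
  else if i == m.+1 then p.1.2 else p.2.
pose t j i := if j < m then base m.+1 else row (r (j - m)) i.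
have TE k : k < 4 -> T k = filled (fun i : 'I_m.+3 => t (m + k) i).
  move=> k4; have -> : (fun i : 'I_m.+3 => t (m + k) i)
      = mul_tuple (r k).2 (r k).1.1 (r k).1.2.
    apply: fill3P => [i im|||]; rewrite /t /row ltnNge leq_addr /= addnC addnK.
    - by rewrite im.
    - by rewrite ltnn eqxx.
    - by rewrite ltnNge leqnSn /= gtn_eqF // eqxx.
    - rewrite ltnNge (_ : m <= m.+2) /=; last by lia.
      by rewrite !gtn_eqF //; lia.
  by move: k k4 => [|[|[|[|]]]].
rewrite TE //; apply: fill_matrix; last first.
- move=> j hj jl; case: (ltnP j m) => jm.
    exists (base m.+2) => i; rewrite /t jm; exact: face_base.
  have := TE (j - m); rewrite subnKC // => <-; last by lia.
  by apply: TP; lia.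
- by lia.
- move=> i j /andP[ij hj]; rewrite /t.
  case: (ltnP i m) => im; case: (ltnP j m) => jm //.
  + by rewrite /row im.
  + lia.
  have [p ip] : exists p, i = p + m by exists (i - m); lia.
  have [q jq] : exists q, j = q + m by exists (j - m); lia.
  subst i j; rewrite !addnK.
  have {im jm ij hj} : p < q < 4 by lia.
  have rw a b : row a (b + m) =
      if b == 0 then a.1.1 else if b == 1 then a.1.2 else a.2.
    rewrite /row (_ : (b + m < m) = false); last by lia.
    rewrite (_ : (b + m == m) = (b == 0)); last by lia.
    by rewrite (_ : (b + m == m.+1) = (b == 1)) //; lia.
  move=> pq; have -> : (q + m).-1 = q.-1 + m by lia.
  by rewrite !rw; move: p q pq => [|[|[|[|p]]]] [|[|[|[|q]]]] //; rewrite andbF.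
Qed.

Section Fill3.
Variable m : nat.
Implicit Types a b c x y z : K m.+1.

Lemma fill3_r a : is_sphere a -> fill3 (base m.+1) a a.
Proof.
move=> sa; exists (degen ord_max a) => i; have hi := ltn_ord i.
have -> : ord_max = inord m.+1 :> 'I_m.+2.
  by apply: val_inj; rewrite /= inordK.
rewrite /mul_tuple -[X in face X _](inord_val i).
case: (ltnP i m.+1) => im.
  rewrite face_degen_lt; last by lia.
  by rewrite sa degen_base; do 2 case: ifP => //; lia.
rewrite (_ : (i.+1 < m.+1) = false); last by lia.
rewrite (_ : (i.+1 == m.+1) = false); last by lia.
rewrite if_same.
have [->|->] : i = m.+1 :> nat \/ i = m.+2 :> nat by lia.
  by rewrite face_degen_id.
by rewrite face_degen_idS.
Qed.

Lemma fill3_l a : is_sphere a -> fill3 a a (base m.+1).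
Proof.
move=> sa; exists (degen (inord m) a) => i; have hi := ltn_ord i.
rewrite /mul_tuple -[X in face X _](inord_val i).
case: (ltnP i m) => im.
  rewrite face_degen_lt; last by lia.
  by rewrite sa degen_base (_ : i.+1 < m.+1).
rewrite (_ : (i.+1 < m.+1) = false); last by lia.
case: (eqVneq (i : nat) m) => [->|im'].
  by rewrite eqxx face_degen_id.
rewrite (_ : (i.+1 == m.+1) = false); last by lia.
case: eqP => [->|im2]; first by rewrite face_degen_idS.
rewrite face_degen_gt; last by lia.
by rewrite sa degen_base.
Qed.

Lemma homotopic_fill3 a b : is_sphere a -> is_sphere b ->
  homotopic a b <-> fill3 (base m.+1) a b.
Proof.
move=> sa sb; rewrite /homotopic /fill3.
have -> : homotopy_tuple a b = mul_tuple b (base m.+1) a.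
  apply/funext => i; rewrite /homotopy_tuple /mul_tuple /= sa degen_base.
  case: (ltnP i m.+1) => im; last first.
    rewrite (_ : (i.+1 < m.+1) = false); last by lia.
    by rewrite (_ : (i.+1 == m.+1) = false) //; lia.
  case: ifP => // h; case: ifP => // /negbT; lia.
by split=> [[]|] //; split=> // i; rewrite sa sb.
Qed.

Lemma fill3_sym a b : is_sphere a ->
  fill3 (base m.+1) a b -> fill3 (base m.+1) b a.
Proof.
move=> sa ab; have s0 := base_is_sphere m.+1.
apply: (@fill4 m (base _) (base _) (base _) a b a 3) => // -[|[|[|[|]]]] //= _ _.
- exact: fill3_r.
- exact: fill3_r.
Qed.

Lemma fill3_trans a b c :
  fill3 (base m.+1) a b -> fill3 (base m.+1) b c -> fill3 (base m.+1) a c.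
Proof.
move=> ab bc; have s0 := base_is_sphere m.+1.
apply: (@fill4 m (base _) (base _) (base _) a b c 2) => // -[|[|[|[|]]]] //= _ _.
exact: fill3_r.
Qed.

Lemma fill3_uniq x x' y y' z z' : is_sphere y ->
  fill3 (base m.+1) x x' -> fill3 (base m.+1) y y' ->
  fill3 y z x -> fill3 y' z' x' -> fill3 (base m.+1) z z'.
Proof.
move=> sy xx' yy' yzx yzx'.
have yzx2 : fill3 y z x'.
  apply: (@fill4 m y y (base _) z x x' 2) => // -[|[|[|[|]]]] //= _ _.
  exact: fill3_l.
by apply: (@fill4 m (base _) y y' z z' x' 1) => // -[|[|[|[|]]]].
Qed.

Lemma fill3_ex x y : is_sphere x -> is_sphere y ->
  exists2 z, is_sphere z & fill3 y z x.
Proof.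
move=> sx sy.
pose t (i : 'I_m.+3) : K m.+1 := mul_tuple x y (base m.+1) i.
have st i : is_sphere (t i).
  have s0 := base_is_sphere m.+1.
  by rewrite /t /mul_tuple; do 3 case: ifP => // _.
have [|w wP] := @pkanP K m.+1 (inord m.+1) t.
  by move=> i j ij _ _; rewrite !st.
have wn i : i <= m.+2 -> i != m.+1 -> face (inord i) w = t (inord i).
  move=> hi im; apply: wP; apply: contra im => /eqP /(congr1 val) /=.
  by rewrite !inordK // => ->.
exists (face (inord m.+1) w).
  move=> i; rewrite -[X in face X _](inord_val i); have hi := ltn_ord i.
  case: (ltnP i m.+1) => im.
    rewrite face_face; last by lia.
    by rewrite wn ?st //; lia.
  have := @face_face K _ m.+1 i.+1 w => /= <-; last by lia.
  by rewrite wn ?st //; lia.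
exists w => i; rewrite /mul_tuple; have hi := ltn_ord i.
case: (eqVneq (i : nat) m.+1) => [im|im].
  rewrite (_ : (i.+1 < m.+1) = false); last by lia.
  rewrite (_ : (i.+1 == m.+1) = false); last by lia.
  by congr (face _ w); apply: val_inj; rewrite /= inordK.
rewrite -[X in face X _](inord_val i) wn // ?inord_val.
by rewrite /t /mul_tuple (negbTE im).
Qed.

End Fill3.

Lemma pi_classP n (x y : sphere n.+1) :
  pi_class x = pi_class y <-> homotopic (sval x) (sval y).
Proof.
have hP (u v : sphere n.+1) :
    homotopic (sval u) (sval v) <-> fill3 (base _) (sval u) (sval v).
  exact: homotopic_fill3 (svalP u) (svalP v).
split=> [/(congr1 sval) /= xy|xy].
  have : hclass y y by apply/hP/fill3_r/(svalP y).
  by rewrite -xy.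
apply: eq_exist; apply/funext => z; apply/propext; split=> /hP h; apply/hP.
  by apply: fill3_trans h; apply: fill3_sym; [exact: (svalP x)|exact/hP].
by apply: fill3_trans h; apply/hP.
Qed.

(* [x][y] = [z] whenever (base, ..., base, y, z, x) is filled. *)
Lemma pi_mulE n (x y z : sphere n) : 0 < n ->
  filled (mul_tuple (sval x) (sval y) (sval z)) ->
  pi_mul (pi_class x) (pi_class y) = pi_class z.
Proof.
case: n x y z => // n x y z _ fz; rewrite /pi_mul.
case: pselect => [h|[]]; last by exists (pi_class z), x, y, z.
case: (cid h) => c /= [x' [y' [z' [xx' yy' -> fz']]]].
have hP (u v : sphere n.+1) :
    pi_class u = pi_class v -> fill3 (base _) (sval u) (sval v).
  by move/pi_classP/(homotopic_fill3 (svalP u) (svalP v)).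
apply/pi_classP/(homotopic_fill3 (svalP z') (svalP z)).
apply: fill3_sym (svalP z) _.
exact: (fill3_uniq (svalP y) (hP _ _ xx') (hP _ _ yy') fz fz').
Qed.

Lemma pi_mul_ex n (x y : sphere n) : 0 < n ->
  exists z : sphere n, filled (mul_tuple (sval x) (sval y) (sval z)).
Proof.
case: n x y => // n x y _.
have [z sz fz] := fill3_ex (svalP x) (svalP y).
by exists (exist _ z sz).
Qed.

Definition pi_trivial n : Prop := forall a : pi n, a = pi_base n.

Local Open Scope ring_scope.

Definition pi_isog (A : zmodType) n : Prop :=
  exists f : pi n -> A,
    bijective f /\ forall a b, f (pi_mul a b) = f a + f b.

End HomotopyGroups.

Definition eilenberg_maclane (A : zmodType) (n : nat) (K : pkan) : Prop :=
  pi_isog K A n /\ forall k, k != n -> pi_trivial K k.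

Definition pkan_isomorphic (K L : pkan) : Prop :=
  exists f : forall n, K n -> L n,
    [/\ forall n (i : 'I_n.+2) (x : K n.+1), f n (face i x) = face i (f n.+1 x),
        forall n (i : 'I_n.+1) (x : K n), f n.+1 (degen i x) = degen i (f n x),
        forall n, bijective (f n)
      & f 0 (pkan_pt K) = pkan_pt L].

(* Main.v *)
Require Import Defs.
From mathcomp Require Import all_boot all_order all_algebra.
From mathcomp Require Import boolp classical_sets.
From mathcomp Require Import zify.

(** Write [n = p.+1].

    Uniqueness rests on the fact that a minimal Eilenberg-Mac Lane space [K] is
    determined by explicit data.  Below dimension [n] it is a point, so every
    [n]-simplex is a sphere and [K n] is in bijection with [A].  By
    minimality, two simplices which agree on all faces but one agree on that
    face too ([minimal_face]).  This turns the vanishing of homotopy groups into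
    the statement that a simplex of dimension other than [n] is determined by
    its boundary ([same_boundary_eq]); together with the Kan condition, every
    matching tuple of simplices of dimension greater than [n] has exactly one
    filler.  The only remaining structure is in dimension [n.+1], where a tuple
    [(a_0, ..., a_(n+1))] of elements of [A] is filled if and only if
    [\sum_i (-1)^i a_i = 0] ([filled_altsum]).  An isomorphism [K -> L] is then
    forced: it is the given bijection in dimension [n], and above it is defined
    by recursion on the dimension, from the images of the faces
    ([em_labelling_iso]).

    The alternating sum relation follows from a commutativity argument.  A tuple
    [a = (a_0, ..., a_(n-1))] acts on [A] by sending [v] to the unique [u] such
    that [(a, u, v)] is filled.  The addition of tuples corresponds to the
    composition of these maps, and the tuples [(0, ..., 0, c)] act by
    translations, which is the definition of the product of [pi_n].  Tuples
    commute, so each of them acts by a map which commutes with all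
    translations, that is, by a translation; the faces of the degenerate
    simplices [s_k c] show that the translation lengths of [c] placed at
    positions [k] and [k + 1] are opposite.

    For existence, the [m]-simplices are the normalized [n]-cocycles of the
    simplex with vertices [0, ..., m] and coefficients in [A].  They form a
    simplicial group, hence a Kan complex ([simplicial_group_kan]).  A cocycle is
    determined by its values on [n]-dimensional faces, and for [m != n] each of
    these is either absent or contained in a proper face; this gives minimality
    and the vanishing of the other homotopy groups, while the cocycle condition
    on an [n.+1]-simplex is the alternating sum relation ([cocycle_em]). *)

Set Implicit Arguments.
Unset Strict Implicit.
Unset Printing Implicit Defensive.

Import GRing.Theory.

(** * Faces of simplices in Kan complexes *)

Section Faces.
Variable K : sset.

Lemma eq_inord m (a : nat) (i : 'I_m.+1) : i = a :> nat -> i = inord a.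
Proof. by move=> <-; rewrite inord_val. Qed.

(** The two iterated faces are the face of [S] opposite to the vertices [a] and
    [b]; [unbump b a] is the rank of [a] among the vertices other than [b]. *)
Lemma face_faceC p (S : K p.+2) a b : a <= p.+2 -> b <= p.+2 -> a != b ->
  face (inord (unbump b a)) (face (inord b) S)
  = face (inord (unbump a b)) (face (inord a) S).
Proof.
wlog ab : a b / a < b => [th ha hb ab|ha hb _].
  by case: (ltngtP a b) ab => // ? _; [|symmetry]; apply: th => //; lia.
have -> : unbump b a = a by rewrite /unbump; lia.
have -> : unbump a b = b.-1 by rewrite /unbump; lia.
by rewrite face_face //; lia.
Qed.

Lemma face_degen_max m (x : K m.+1) :
  face ord0 (degen ord_max x) = degen ord_max (face ord0 x).
Proof.
have -> : ord0 = inord 0 :> 'I_m.+3 by apply: eq_inord.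
have -> : ord_max = inord m.+1 :> 'I_m.+2 by apply: eq_inord.
rewrite face_degen_lt ?leqnn //.
have -> : inord m.+1.-1 = ord_max :> 'I_m.+1 by symmetry; apply: eq_inord.
by have -> : inord 0 = ord0 :> 'I_m.+2 by symmetry; apply: eq_inord.
Qed.

Lemma face_faceE p (S : K p.+2) b j : b <= p.+2 -> j <= p.+1 ->
  face (inord j) (face (inord b) S)
  = face (inord (unbump (bump b j) b)) (face (inord (bump b j)) S).
Proof.
move=> hb hj; rewrite -{1}(bumpK b j) face_faceC //; rewrite /bump; lia.
Qed.

Lemma same_boundaryE m (x y : K m.+1) :
  (forall i, i <= m.+1 -> face (inord i) x = face (inord i) y) ->
  same_boundary x y.
Proof. by move=> h i; have := h i; rewrite inord_val; apply; case: i. Qed.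

Lemma filled_homotopy m (x y : K m) (u : K m.+1) :
  (forall j, j <= m -> face (inord j) u = face (inord j) (degen (inord m) x)) ->
  face (inord m.+1) u = y -> filled (homotopy_tuple x y).
Proof.
move=> hu hy; exists u => i; have hi := ltn_ord i.
rewrite -[X in face X _](inord_val i) /homotopy_tuple.
case: (ltngtP (i : nat) m) => im.
- rewrite hu ?(ltnW im) //; case: m x y u hu hy i hi im => // m x y u _ _ i hi im.
  rewrite face_degen_lt; last by lia.
  by congr (degen _ _); apply/val_inj; rewrite /= inordK.
- by rewrite -hy; congr (face (inord _) u); lia.
- by rewrite im hu // face_degen_id.
Qed.

End Faces.

(** * Minimal Kan complexes: simplices determined by their boundary *)

Section Minimal.
Variable K : pkan.

(** A simplex [S] with its face [a] replaced by [v].  The horn to be filled omits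
    the [b]-th face, so [v] is free on the face that it shares with [d_b S]. *)
Lemma replace_face p (S : K p.+2) a b (v : K p.+1) :
  a <= p.+2 -> b <= p.+2 -> a != b ->
  (forall i, i <= p.+1 -> i != unbump a b ->
     face (inord i) v = face (inord i) (face (inord a) S)) ->
  exists W : K p.+2, face (inord a) W = v /\
    forall i, i <= p.+2 -> i != a -> i != b ->
      face (inord i) W = face (inord i) S.
Proof.
move=> ha hb ab hv.
have [|W WP] := @pkanP K p.+1 (inord b)
    (fun i => if i == a :> nat then v else face i S).
  move=> i j ij ib jb.
  have hi := ltn_ord i; have hj := ltn_ord j.
  have neq (l : 'I_p.+3) : l != inord b -> l != b :> nat.
    by apply: contra => /eqP lk; apply/eqP/val_inj; rewrite /= inordK.
  move/neq in ib; move/neq in jb.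
  have Sij : face (inord i) (face j S) = face (inord j.-1) (face i S).
    by rewrite -{1}(inord_val j) -{2}(inord_val i) face_face //; lia.
  case: (eqVneq (i : nat) a) => [ia|ia]; case: (eqVneq (j : nat) a) => [ja|ja].
  - lia.
  - rewrite Sij hv; [|lia|rewrite /unbump; lia].
    by rewrite -ia inord_val.
  - rewrite hv; [|lia|rewrite /unbump; lia].
    by rewrite -ja inord_val Sij.
  - exact: Sij.
have Wi i : i <= p.+2 -> i != b ->
    face (inord i) W = if i == a then v else face (inord i) S.
  move=> hi ib; rewrite WP ?inordK //.
  by apply: contra ib => /eqP /(congr1 val) /=; rewrite !inordK // => ->.
exists W; split; first by rewrite Wi // eqxx.
by move=> i hi ia ib; rewrite Wi // (negbTE ia).
Qed.

Hypothesis minK : minimal K.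

(** The degenerate simplex [s_(m+1) w] (or [s_m w], when [b = m.+1]) has two
    consecutive faces equal to [w], and another face equal to the last degeneracy
    of [d_b w].  Replacing one of the former by [w'] changes a single entry of the
    boundary of the latter, from [d_b w] to [d_b w'], and so makes it a homotopy
    from [d_b w] to [d_b w']. *)
Lemma minimal_face m (w w' : K m.+1) b : b <= m.+1 ->
  (forall i, i <= m.+1 -> i != b -> face (inord i) w = face (inord i) w') ->
  face (inord b) w = face (inord b) w'.
Proof.
move=> hb ww'.
have sb : same_boundary (face (inord b) w) (face (inord b) w').
  case: m w w' hb ww' => // m w w' hb ww'; apply: same_boundaryE => j hj.
  rewrite face_faceE // [RHS]face_faceE // ww' // 1?eq_sym ?neq_bump // /bump; lia.
apply: minK => //; split=> //.
case: (leqP b m) => [bm|bm].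
  pose S : K m.+2 := degen (inord m.+1) w.
  have [||||W [Wa Wi]] := @replace_face m S m.+2 b w'; rewrite ?leqnn //; try lia.
    move=> i hi ib; rewrite face_degen_idS // ww' //.
    by apply: contra ib => /eqP ->; rewrite /unbump; apply/eqP; lia.
  apply: (@filled_homotopy _ _ _ _ (face (inord b) W)) => [j jm|].
    have -> : degen (inord m) (face (inord b) w) = face (inord b) S.
      by rewrite /S face_degen_lt //; lia.
    have E T := @face_faceE K m T b j (leqW hb) (leqW jm).
    by rewrite E [RHS]E Wi // /bump; lia.
  have := @face_faceC K m W m.+2 b (leqnn _) (leqW hb) _.
  have -> : unbump b m.+2 = m.+1 by rewrite /unbump; lia.
  have -> : unbump m.+2 b = b by rewrite /unbump; lia.
  by rewrite Wa; apply; lia.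
have -> : b = m.+1 by lia.
pose S : K m.+2 := degen (inord m) w.
have [||||W [Wa Wi]] := @replace_face m S m.+1 m.+2 w'; rewrite ?leqnn //; try lia.
  move=> i hi ib; rewrite face_degen_idS // ww' //.
  by apply: contra ib => /eqP ->; rewrite /unbump; apply/eqP; lia.
apply: (@filled_homotopy _ _ _ _ (face (inord m.+2) W)) => [j jm|].
  have -> : degen (inord m) (face (inord m.+1) w) = face (inord m.+2) S.
    by rewrite /S face_degen_gt //; lia.
  have E T := @face_faceE K m T m.+2 j (leqnn _) (leqW jm).
  by rewrite E [RHS]E Wi // /bump; lia.
have := @face_faceC K m W m.+1 m.+2 (leqnSn _) (leqnn _) _.
have -> : unbump m.+2 m.+1 = m.+1 by rewrite /unbump; lia.
have -> : unbump m.+1 m.+2 = m.+1 by rewrite /unbump; lia.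
by rewrite Wa; apply; lia.
Qed.

(** In a minimal complex, rigidity of all [m]-simplices plays the part of the
    vanishing of the [m]-th homotopy group; unlike [is_sphere], it can be
    transported from a simplex to its neighbours. *)
Definition rigid m (x : K m) := forall y : K m, same_boundary x y -> x = y.

(** If [y] has the boundary of [d_b S], then [d_b S] can be replaced by [y] in
    [S], at the cost of changing [d_a S] to a simplex with the same boundary.
    When the latter is rigid nothing changes there, and [minimal_face] gives
    [y = d_b S]. *)
Lemma rigid_face p (S : K p.+2) a b : a <= p.+2 -> b <= p.+2 -> a != b ->
  rigid (face (inord a) S) -> rigid (face (inord b) S).
Proof.
move=> ha hb ab rS y Sy.
have ba : b != a by rewrite eq_sym.
have [||||W [Wb Wi]] := @replace_face p S b a y => //.
rewrite -Wb; apply: minimal_face => // i hi ib.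
case: (eqVneq i a) => [->|ia]; last by rewrite Wi.
apply/rS/same_boundaryE => j hj.
rewrite face_faceE // [RHS]face_faceE //.
case: (eqVneq (bump a j) b) => [->|jb]; first by rewrite Wb.
by rewrite Wi // /bump; lia.
Qed.

(** The simplex with vertices [1, ..., m+1, m+1]: one step of the contraction of
    a simplex to its last vertex. *)
Let shift m (x : K m.+1) : K m.+1 := degen ord_max (face ord0 x).

(** Both [x] and [shift x] are faces of the last degeneracy of [x]. *)
Lemma rigid_shift m (x : K m.+1) : rigid (shift x) -> rigid x.
Proof.
pose S : K m.+2 := degen ord_max x.
have -> : shift x = face (inord 0) S.
  by rewrite /shift -face_degen_max; congr (face _ S); apply: eq_inord.
have xS : face (inord m.+1) S = x.
  rewrite /S (_ : ord_max = inord m.+1) ?face_degen_id //.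
  exact: eq_inord.
by rewrite -[in rigid x]xS; apply: rigid_face.
Qed.

(** The contraction ends at a degeneracy of a vertex. *)
Lemma iter_shift m (x : K m.+1) : (forall y : K 0, y = pkan_pt K) ->
  iter m.+1 (@shift m) x = base K m.+1.
Proof.
move=> K0; elim: m x => [|m IHm] x.
  by rewrite /= /shift (K0 (face _ _)) -[pkan_pt K]/(base K 0) degen_base.
rewrite iterSr {2}/shift.
have sE k y : iter k (@shift m.+1) (degen ord_max y)
    = degen ord_max (iter k (@shift m) y).
  by elim: k => //= k ->; rewrite {1}/shift face_degen_max.
by rewrite sE IHm degen_base.
Qed.

Lemma sphere_eq_base m (x : K m) : pi_trivial K m -> is_sphere x -> x = base K m.
Proof.
move=> tK sx; apply: minK.
- case: m x tK sx => // m x _ sx i; by rewrite sx face_base.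
- have := tK (pi_class (exist _ x sx)).
  case: m x tK sx => [|m] x _ sx; last by move/pi_classP.
  move/(congr1 sval) => /= h.
  suff : hclass (sphere_base K 0) (sphere_base K 0) by rewrite -h.
  split=> //; exists (degen (inord 0) (pkan_pt K)) => i.
  rewrite -[X in face X _](inord_val i) /homotopy_tuple.
  have [->|->] : i = 0 :> nat \/ i = 1 :> nat by have := ltn_ord i; lia.
    by rewrite face_degen_id.
  by rewrite face_degen_idS.
Qed.

(** Base simplices are rigid since the homotopy group at the base point is
    trivial; rigidity is transported to [x] along the contraction of [x] to its
    last vertex. *)
Lemma same_boundary_eq m (x y : K m.+1) :
  pi_trivial K 0 -> pi_trivial K m.+1 -> same_boundary x y -> x = y.
Proof.
move=> t0 tm; suff : rigid x by apply.
have K0 (z : K 0) : z = pkan_pt K by exact: (@sphere_eq_base 0).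
have rigid_iter k : rigid (iter k (@shift m) x) -> rigid x.
  by elim: k => //= k IHk /rigid_shift.
apply: (rigid_iter m.+1); rewrite iter_shift // => z hz; symmetry.
by apply: sphere_eq_base => // i; rewrite -hz face_base.
Qed.

End Minimal.

(** * The alternating sum relation *)

Local Open Scope ring_scope.

Lemma mulrz_sign_eq0 (A : zmodType) (a : A) k : a *~ (-1) ^+ k = 0 -> a = 0.
Proof.
move/(congr1 (fun x => x *~ (-1) ^+ k)).
by rewrite -mulrzA -expr2 sqrr_sign mul0rz.
Qed.

(** In this section [psi] labels the simplices of dimension [p.+1] by elements of
    [A], in a way that is compatible with the product of the homotopy group. *)
Section Relation.
Variables (A : zmodType) (p : nat) (K : pkan).
Hypothesis minK : minimal K.
Hypothesis K_p : forall x : K p, x = base K p.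
Variables (psi : A -> K p.+1).
Hypothesis psi_bij : bijective psi.
Hypothesis psi0 : psi 0 = base K p.+1.
Hypothesis psi_add : forall x y z : A,
  fill3 (psi y) (psi z) (psi x) <-> z = x + y.

(** Labels are indexed by all natural numbers to avoid ordinal casts; only the
    first [p.+3] matter. *)
Let R (t : nat -> A) := filled (fun i : 'I_p.+3 => psi (t i)).

Let R_ext s t : (forall i, (i < p.+3)%N -> s i = t i) -> R s -> R t.
Proof.
move=> st; rewrite /R; congr filled; apply/funext => i; congr psi.
exact: st.
Qed.

Let R_fun s t b : (b < p.+3)%N ->
  (forall i, (i < p.+3)%N -> i != b -> s i = t i) -> R s -> R t -> s b = t b.
Proof.
move=> hb st [u uP] [v vP]; apply: (bij_inj psi_bij).
have uE i : (i < p.+3)%N -> face (inord i) u = psi (s i).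
  by move=> hi; rewrite uP inordK.
have vE i : (i < p.+3)%N -> face (inord i) v = psi (t i).
  by move=> hi; rewrite vP inordK.
rewrite -uE // -vE //; apply: (minimal_face minK) => // i hi ib.
by rewrite uE // vE // st.
Qed.

Let R_mul a x y z :
  (forall i, (i < p)%N -> a i = 0) -> a p = y -> a p.+1 = z -> a p.+2 = x ->
  R a <-> z = x + y.
Proof.
move=> a0 ap ap1 ap2; rewrite -psi_add /fill3 /R.
rewrite (@fill3P K p (fun i => psi (a i)) (psi y) (psi z) (psi x)) //.
- by move=> i ip; rewrite a0.
- by rewrite ap.
- by rewrite ap1.
- by rewrite ap2.
Qed.

Let R_total (a : nat -> A) v : exists u,
  R (fun i => if (i < p.+1)%N then a i else if i == p.+1 then u else v).
Proof.
have [phi phiK psiK] := psi_bij.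
pose t i := if (i < p.+1)%N then a i else v.
have [|w wP] := @pkanP K p.+1 (inord p.+1) (fun i => psi (t i)).
  by move=> i j _ _ _; rewrite [LHS]K_p [RHS]K_p.
exists (phi (face (inord p.+1) w)); exists w => i.
case: (eqVneq i (inord p.+1)) => [->|ip].
  by rewrite inordK // ltnn eqxx psiK.
rewrite wP // /t; case: ifP => // h; case: eqP => // ip1.
by case/eqP: ip; apply: eq_inord.
Qed.

(** The rows [x], [y] and the rows [(0, ..., 0, y_l, x_l + y_l, x_l)], which are
    products, make up all the rows but one of a matrix [t] as in [fill_matrix];
    [b l r] is the label of the face opposite to the vertices [l < r]. *)
Let R_comp x y : x p.+1 = y p.+2 -> R x -> R y ->
  R (fun i => if (i < p.+1)%N then x i + y i
              else if i == p.+1 then y p.+1 else x p.+2).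
Proof.
move=> xy Rx Ry.
pose z i := if (i < p.+1)%N then x i + y i else y i.
pose b l r := if (r < p.+1)%N then 0 else if r == p.+1 then y l
  else if r == p.+2 then z l else x l.
pose t j i := psi (if (i < j)%N then b i j else b j i.+1).
have b1 l : b l p.+1 = y l by rewrite /b ltnn eqxx.
have b2 l : b l p.+2 = z l.
  rewrite /b eqxx; do 2 (case: ifP => [|_]; first by lia); done.
have b3 l : b l p.+3 = x l.
  rewrite /b; do 3 (case: ifP => [|_]; first by lia); done.
have rowE k a : (forall i, (i < p.+3)%N ->
    (if (i < k)%N then b i k else b k i.+1) = a i) ->
    filled (fun i : 'I_p.+3 => t k i) = R a.
  by move=> h; rewrite /R; congr filled; apply/funext => i; rewrite /t h.
rewrite -(rowE p.+2); last first.
  move=> i hi; case: ltnP => hi2.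
    rewrite b2 /z; case: ifP => // h; case: eqP => [->//|]; lia.
  have -> : i = p.+2 by lia.
  rewrite b3; do 2 (case: ifP => [|_]; first by lia); done.
apply: fill_matrix => //.
  move=> i j /andP[ij hj]; rewrite /t ij.
  rewrite (_ : (j.-1 < i)%N = false); last by lia.
  by rewrite prednK //; lia.
move=> j hj jp.
have [->|[->|jp1]] : j = p.+3 \/ j = p.+1 \/ (j < p.+1)%N by lia.
- by rewrite (rowE _ x) // => i hi; rewrite hi b3.
- rewrite (rowE _ y) // => i hi; rewrite b1.
  case: ltnP => // h.
  have [->|->] : i = p.+1 \/ i = p.+2 by lia.
    by rewrite b2 /z ltnn.
  by rewrite b3.
- pose a i := if (i < j)%N then b i j else b j i.+1.
  have aS i : (j <= i)%N -> a i = b j i.+1 by rewrite /a ltnNge => ->.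
  rewrite (rowE _ a) //; apply/(@R_mul a (x j) (y j) (z j)) => //.
  + by move=> i ip; rewrite /a /b jp1 ltnS ip if_same.
  + by rewrite aS ?b1.
  + by rewrite aS ?b2 //; lia.
  + by rewrite aS ?b3 //; lia.
  + by rewrite /z jp1.
Qed.

(** For fixed [a], this is the graph of a map from [v] to [u], which is the
    action of [a] on [A]. *)
Let G (a : nat -> A) u v :=
  R (fun i => if (i < p.+1)%N then a i else if i == p.+1 then u else v).

Let G_ext a b u v : (forall i, (i < p.+1)%N -> a i = b i) -> G a u v -> G b u v.
Proof. by move=> ab; apply: R_ext => i _; case: ifP => // h; apply: ab. Qed.

Let G_fun a u u' v : G a u v -> G a u' v -> u = u'.
Proof.
move=> h h'; have := R_fun _ _ h h' => /(_ p.+1); rewrite ltnn eqxx; apply=> //.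
by move=> i _ ip; rewrite (negbTE ip).
Qed.

Let G_comp a b u v w : G a u v -> G b w u -> G (fun i => a i + b i) w v.
Proof.
have F2 : (p.+2 < p.+1)%N = false by lia.
have F3 : (p.+2 == p.+1)%N = false by lia.
move=> h h'; apply: R_ext (R_comp _ h h') => [i _|]; rewrite /= ltnn eqxx F2 F3 //.
by case: (i < p.+1)%N.
Qed.

Let single k c (i : nat) : A := if i == k then c else 0.

Let G_translate c u v : G (single p c) u v <-> u = v + c.
Proof.
apply: R_mul => [i ip|||] //=.
- by rewrite ltnS (ltnW ip) /single ltn_eqF.
- by rewrite ltnSn /single eqxx.
- by rewrite ltnn eqxx.
- do 2 (case: ifP => [|_]; first by lia); done.
Qed.

(** The action of [a] commutes with the translation by [c], because it is the
    action of the tuple [(0, ..., 0, c)], and tuples commute under addition. *)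
Let G_shift a u v c : G a u v -> G a (u + c) (v + c).
Proof.
move=> h; have [u' h'] := R_total a (v + c); rewrite -/(G _ _ _) in h'.
have /G_comp/(_ h') h1 : G (single p c) (v + c) v by apply/G_translate.
have /(G_comp h) h2 : G (single p c) (u + c) u by apply/G_translate.
rewrite (@G_fun _ (u + c) u' v h2) //.
by apply: G_ext h1 => i _; rewrite addrC.
Qed.

Let G_add a b u v : G a u 0 -> G b v 0 -> G (fun i => a i + b i) (u + v) 0.
Proof.
move=> /(@G_shift _ _ _ v); rewrite add0r => h /G_comp/(_ h).
by apply: G_ext => i _; rewrite addrC.
Qed.

Let G0 : G (fun=> 0) 0 0.
Proof.
apply/(@R_mul _ 0 0 0); rewrite ?addr0 // => *; do ?case: ifP => //.
Qed.

(** The faces of [s_k c] are [c] at the positions [k] and [k + 1], and the base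
    simplex elsewhere.  For [k = p] the second position is that of [u]. *)
Let R_degen k c : (k < p.+1)%N -> G (fun i => single k c i + single k.+1 c i)
   (if k == p then c else 0) 0.
Proof.
move=> hk; exists (degen (inord k) (psi c)) => i; have hi := ltn_ord i.
rewrite -[X in face X _](inord_val i) /single.
have dg (j l : nat) : degen (inord j) (face (inord l) (psi c)) = psi 0.
  by rewrite (K_p (face _ _)) degen_base psi0.
case: (ltngtP i k) => ik.
- rewrite face_degen_lt; last by lia.
  rewrite dg; congr psi; case: ifP => [_|]; last by lia.
  by case: ifP => [|_]; [lia|rewrite addr0].
- case: (eqVneq (i : nat) k.+1) => [ik1|ik1].
    rewrite ik1 face_degen_idS ?(ltnW hk) //; congr psi.
    rewrite add0r ltnS eqSS; case: (ltngtP k p) => // kp; lia.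
  rewrite face_degen_gt; last by lia.
  rewrite dg addr0; case: ifP => // h1; case: ifP => // h2.
  case: ifP => // h3; lia.
- by rewrite ik face_degen_id ?(ltnW hk) // hk ltn_eqF // addr0.
Qed.

(** Descending induction on [k], from the translations at [k = p]. *)
Let tau k c : (k < p.+1)%N -> G (single k c) (c *~ (-1) ^+ (p + k)) 0.
Proof.
move=> hk; have -> : k = (p - (p - k))%N by lia.
have := leq_subr k p; elim: (p - k)%N => {hk} [_|d IHd hd].
  by rewrite subn0 exprD -expr2 sqrr_sign; apply/G_translate; rewrite add0r.
have /IHd {}IHd : (d <= p)%N by lia.
set l := (p - d.+1)%N in IHd *; have lE : (p - d)%N = l.+1 by rewrite /l; lia.
rewrite lE in IHd.
have [u hu] := R_total (single l c) 0; rewrite -/(G _ _ _) in hu.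
have hl : (l < p.+1)%N by lia.
have := G_fun (G_add hu IHd) (R_degen c hl).
rewrite (_ : (l == p) = false); last by lia.
move/eqP; rewrite addr_eq0 => /eqP uE.
by move: hu; rewrite uE addnS exprS mulN1r mulrNz opprK.
Qed.

Let tau_sum (a : nat -> A) k : (k <= p.+1)%N ->
  G (fun i => if (i < k)%N then a i else 0)
    (\sum_(i < k) a i *~ (-1) ^+ (p + i)) 0.
Proof.
elim: k => [_|k IHk hk]; first by rewrite big_ord0; exact: G0.
rewrite big_ord_recr /=.
have := G_add (IHk (ltnW hk)) (tau (a k) hk).
apply: G_ext => i _; rewrite ltnS /single.
by case: (ltngtP i k) => [||->]; rewrite ?addr0 ?add0r.
Qed.

(** By [G_shift] the action of a tuple is the translation by its value at [0],
    which [tau_sum] computes. *)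
Lemma filled_altsum (t : 'I_p.+3 -> A) :
  filled (fun i => psi (t i)) <-> \sum_i t i *~ (-1) ^+ i = 0.
Proof.
pose s (i : nat) := t (inord i).
have sE (i : 'I_p.+3) : t i = s i by rewrite /s inord_val.
have -> : (fun i => psi (t i)) = (fun i : 'I_p.+3 => psi (s i)).
  by apply/funext => i; rewrite sE.
rewrite (eq_bigr (fun i : 'I_p.+3 => s i *~ (-1) ^+ i)) => [|i _]; last by rewrite sE.
rewrite big_ord_recr big_ord_recr /=.
pose S := \sum_(i < p.+1) s i *~ (-1) ^+ (p + i).
have GS : G s (S + s p.+2) (s p.+2).
  have := G_shift (s p.+2) (tau_sum s (leqnn p.+1)); rewrite add0r.
  by apply: G_ext => i ->.
have -> : \sum_(i < p.+1) s i *~ (-1) ^+ i = S *~ (-1) ^+ p.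
  rewrite mulrz_suml; apply: eq_bigr => i _.
  by rewrite -mulrzA exprD mulrAC -expr2 sqrr_sign mul1r.
rewrite !exprS !mulN1r !mulrNz opprK -mulrzBl -mulrzDl.
have -> : (S - s p.+1 + s p.+2) *~ (-1) ^+ p = 0 <-> s p.+1 = S + s p.+2.
  rewrite addrAC; split=> [|->]; last by rewrite subrr mul0rz.
  by move/mulrz_sign_eq0/eqP; rewrite subr_eq0 => /eqP.
have sG u : u = s p.+1 -> forall i, (i < p.+3)%N -> s i =
    if (i < p.+1)%N then s i else if i == p.+1 then u else s p.+2.
  move=> -> i hi; case: ifP => // h1; case: eqP => [->//|h2]; congr s; lia.
split=> [h|e]; last by apply: R_ext GS => i hi; rewrite -sG.
apply: (@G_fun s _ _ (s p.+2)) GS.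
by apply: R_ext h => i hi; rewrite -sG.
Qed.

End Relation.

(** * Comparing two minimal Eilenberg-Mac Lane spaces *)

(** A labelling in the single dimension [p.+1] is used as a family over all
    dimensions, so that recursions on the dimension need no cast. *)
Lemma extend_family (T : nat -> Type) (A : Type) (a0 : A) n (g : T n -> A) :
  exists G : forall m, T m -> A, G n = g.
Proof.
exists (fun m x => match m =P n with
  | ReflectT e => g (ecast k (T k) e x) | _ => a0 end).
by apply/funext => x; case: eqP => // e; rewrite eq_axiomK.
Qed.

Lemma pi_classE (K : pkan) n (a : Defs.pi K n) : exists x, a = pi_class x.
Proof. by case: a => C [x e]; exists x; apply: eq_exist. Qed.

(** The necessary condition for a tuple to be the boundary of a simplex. *)
Definition matching_tuple (K : sset) m (t : 'I_m.+3 -> K m.+1) : Prop :=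
  forall i j : 'I_m.+3, (i < j)%N ->
    face (inord i) (t j) = face (inord j.-1) (t i).

(** A presentation of a complex by elements of [A] which leaves no freedom: a
    point below dimension [p.+1], then [A], then the alternating sum relation,
    then unique fillers. *)
Record em_labelling (A : zmodType) p (K : pkan) (phi : forall m, K m -> A) :
    Prop := EmLabelling {
  label_point : forall m (x y : K m), (m <= p)%N -> x = y;
  label_bij : bijective (phi p.+1);
  label_base : phi p.+1 (base K p.+1) = 0;
  label_filled : forall t : 'I_p.+3 -> K p.+1,
    filled t <-> \sum_i phi p.+1 (t i) *~ (-1) ^+ i = 0;
  label_uniq : forall m (x y : K m), m != p.+1 -> same_boundary x y -> x = y;
  label_fill : forall m (t : 'I_m.+3 -> K m.+1), (p < m)%N ->
    matching_tuple t -> filled t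
}.

(** All simplices of dimension [p.+1] are spheres and are pairwise not homotopic,
    so the isomorphism between the homotopy group and [A] is a labelling.  A
    matching tuple of higher dimension is filled because its horn omitting the
    face [0] has a filler, whose face [0] has the right boundary. *)
Lemma minimal_em_labelling (A : zmodType) p (K : pkan) :
  minimal K -> eilenberg_maclane A p.+1 K ->
  exists phi : forall m, K m -> A, em_labelling p phi.
Proof.
move=> minK [[f [f_bij f_mul]] K_triv].
have t0 : pi_trivial K 0 by apply: K_triv.
have low m (x : K m) : (m <= p)%N -> x = base K m.
  elim: m x => [|m IHm] x mp; apply: sphere_eq_base => //; try by apply: K_triv; lia.
  by move=> i /=; apply: IHm; lia.
have sph (x : K p.+1) : is_sphere x by move=> i; apply: low.
pose sp (x : K p.+1) : sphere K p.+1 := exist _ x (sph x).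
pose cl x := pi_class (sp x).
have cl_inj : injective cl.
  by move=> x y /pi_classP; apply: minK => i; rewrite !sph.
have clE a : exists x, cl x = a.
  have [[x sx] ->] := pi_classE a; exists x; congr pi_class; exact: eq_exist.
have [g gK fK] := f_bij.
have /choice[psi psiE] (c : A) : exists x, f (cl x) = c.
  by have [x xE] := clE (g c); exists x; rewrite xE fK.
have psiK : cancel (fun x => f (cl x)) psi.
  by move=> x; apply/cl_inj/(bij_inj f_bij); rewrite psiE.
have psi_bij : bijective psi by exists (fun x => f (cl x)).
have [phi phiE] := @extend_family K A 0 p.+1 (fun x => f (cl x)).
have fill_add x y z : fill3 y z x -> f (cl z) = f (cl x) + f (cl y).
  by move=> h; rewrite -f_mul (@pi_mulE K p.+1 (sp x) (sp y) (sp z)).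
have psi_add x y z : fill3 (psi y) (psi z) (psi x) <-> z = x + y.
  split=> [/fill_add|->]; first by rewrite !psiE.
  have [z' h] := pi_mul_ex (sp (psi x)) (sp (psi y)) isT.
  suff -> : psi (x + y) = sval z' by [].
  by apply: (can_inj psiK); rewrite psiE (fill_add _ _ _ h) !psiE.
have b0 : f (cl (base K p.+1)) = 0.
  have := fill_add _ _ _ (fill3_l (base_is_sphere K p.+1)).
  by move/eqP; rewrite -subr_eq subrr eq_sym => /eqP.
have psi0 : psi 0 = base K p.+1 by rewrite -b0 psiK.
exists phi; split.
- by move=> m x y mp; rewrite [x]low // [y]low.
- by rewrite phiE; exists psi.
- by rewrite phiE.
- move=> t; rewrite phiE.
  have := filled_altsum minK (fun x => low p x (leqnn p)) psi_bij psi0 psi_add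
    (fun i => f (cl (t i))).
  by have -> : (fun i => psi (f (cl (t i)))) = t by apply/funext => i.
- move=> [|m] x y mp xy; first by rewrite [x]low // [y]low.
  by apply: same_boundary_eq xy => //; apply: K_triv.
- move=> m t mp tC.
  have [|w wP] := @pkanP K m.+1 ord0 t.
    by move=> i j ij _ _; apply: tC.
  exists w => i; case: (eqVneq i ord0) => [->|]; last exact: wP.
  have [e0 e1] : inord 0 = ord0 :> 'I_m.+3 /\ inord 0 = ord0 :> 'I_m.+2.
    by split; symmetry; apply: eq_inord.
  apply: same_boundary_eq => //; first by apply: K_triv; lia.
  apply: same_boundaryE => j hj.
  have := @face_face K m 0 j.+1 w; rewrite e0 e1 => <- //.
  rewrite wP; last by apply/eqP => /(congr1 val); rewrite /= inordK.
  have := tC ord0 (inord j.+1); rewrite inordK //= e1; exact.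
Qed.

(** Simplices correspond when all their faces of dimension [p.+1] have equal
    labels.  A relation rather than a map, so that its totality and uniqueness
    can be proved separately, and for both directions at once. *)
Fixpoint corr (A : zmodType) p (K L : pkan)
    (phiK : forall m, K m -> A) (phiL : forall m, L m -> A)
    m : K m -> L m -> Prop :=
  match m with
  | 0 => fun _ _ => True
  | m'.+1 => fun x y => (m'.+1 = p.+1 -> phiK _ x = phiL _ y) /\
      forall i : 'I_m'.+2, corr p phiK phiL (face i x) (face i y)
  end.

Lemma corr_sym (A : zmodType) p (K L : pkan)
    (phiK : forall m, K m -> A) (phiL : forall m, L m -> A) m
    (x : K m) (y : L m) : corr p phiK phiL x y -> corr p phiL phiK y x.
Proof.
elim: m x y => //= m IHm x y [e h]; split=> [/e //|i].
exact: IHm.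
Qed.

Section Correspondence.
Variables (A : zmodType) (p : nat) (K L : pkan)
    (phiK : forall m, K m -> A) (phiL : forall m, L m -> A).
Hypotheses (labK : em_labelling p phiK) (labL : em_labelling p phiL).

Lemma corr_low m (x : K m) (y : L m) : (m <= p)%N -> corr p phiK phiL x y.
Proof.
elim: m x y => //= m IHm x y mp; split=> [|i]; first by lia.
by apply: IHm; lia.
Qed.

Lemma corr_fun m (x : K m) (y y' : L m) :
  corr p phiK phiL x y -> corr p phiK phiL x y' -> y = y'.
Proof.
elim: m x y y' => [|m IHm] x y y'; first by move=> _ _; apply: (label_point labL).
move=> [e h] [e' h']; case: (eqVneq m.+1 p.+1) => mp.
  case: mp => mp; subst m.
  by apply: (bij_inj (label_bij labL)); rewrite -e // -e'.
apply: (label_uniq labL) => // i; exact: IHm (h i) (h' i).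
Qed.

(** For [x] of dimension greater than [p.+1], the simplices that correspond to the
    faces of [x] form a tuple, which is filled because it satisfies the
    alternating sum relation when [x] has dimension [p.+2], and because it matches
    when the dimension is greater. *)
Lemma corr_total m (x : K m) : exists y : L m, corr p phiK phiL x y.
Proof.
elim: m x => [|m IHm] x; first by exists (pkan_pt L).
have /choice[t tP] i := IHm (face i x).
case: (ltngtP m p) => mp.
- by exists (base L m.+1); apply: corr_low.
- have [y yP] : filled t; last first.
    exists y; split=> [|i]; first by lia.
    by rewrite yP.
  case: m x IHm t tP mp => [|m] x IHm t tP mp; first by [].
  case: (ltngtP m p) => mp'; [by lia| |].
    apply: (label_fill labL) => // i j ij; have hi := ltn_ord i; have hj := ltn_ord j.
    apply: (@corr_fun m (face (inord i) (face j x))).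
      by case: (tP j) => _; apply.
    case: (tP i) => _ /(_ (inord j.-1)).
    rewrite -[X in face (inord i) (face X x)](inord_val j) face_face ?inord_val //; lia.
  subst m; apply/(label_filled labL).
  rewrite -[RHS](proj1 (label_filled labK (fun i => face i x))); last by exists x.
  by apply: eq_bigr => i _; case: (tP i) => e _; rewrite e.
- subst m; have [psi psiK phiKE] := label_bij labL.
  exists (psi (phiK x)); split=> [_|i]; first by rewrite phiKE.
  exact: corr_low.
Qed.

Lemma corr_degen m (i : 'I_m.+1) (x : K m) (y : L m) :
  corr p phiK phiL x y -> corr p phiK phiL (degen i x) (degen i y).
Proof.
elim: m i x y => [|m IHm] i x y xy; split.
- move=> [p0]; subst p.
  rewrite (label_point labK x (base K 0)) // (label_point labL y (base L 0)) //.
  by rewrite !degen_base (label_base labK) (label_base labL).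
- by [].
- move=> [mp]; subst p.
  rewrite (label_point labK x (base K _)) // (label_point labL y (base L _)) //.
  by rewrite !degen_base (label_base labK) (label_base labL).
- move=> j; have hi := ltn_ord i; have hj := ltn_ord j.
  case: (xy) => _ xyf.
  rewrite -(inord_val i) -(inord_val j).
  case: (ltngtP (j : nat) i) => ji.
  + by rewrite !face_degen_lt; [apply: IHm; apply: xyf|lia..].
  + case: (eqVneq (j : nat) i.+1) => [->|ji'].
      by rewrite !face_degen_idS; [|lia..].
    by rewrite !face_degen_gt; [apply: IHm; apply: xyf|lia..].
  + by rewrite ji !face_degen_id; [|lia..].
Qed.

End Correspondence.

Lemma em_labelling_iso (A : zmodType) p (K L : pkan)
    (phiK : forall m, K m -> A) (phiL : forall m, L m -> A) :
  em_labelling p phiK -> em_labelling p phiL -> pkan_isomorphic K L.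
Proof.
move=> labK labL.
have [f fP] : exists f : forall m, K m -> L m,
    forall m x, corr p phiK phiL x (f m x).
  exists (fun m x => sval (cid (corr_total labK labL x))) => m x.
  by case: cid.
have [g gP] : exists g : forall m, L m -> K m,
    forall m y, corr p phiL phiK y (g m y).
  exists (fun m y => sval (cid (corr_total labL labK y))) => m y.
  by case: cid.
exists f; split.
- move=> n i x; apply: (corr_fun labL (fP _ _)).
  by case: (fP _ x) => _; apply.
- move=> n i x; apply: (corr_fun labL (fP _ _)).
  exact: corr_degen.
- move=> m; exists (g m) => x.
    exact: (corr_fun labK (gP _ _) (corr_sym (fP _ _))).
  exact: (corr_fun labL (fP _ _) (corr_sym (gP _ _))).
- exact: (label_point labL).
Qed.

(** * Simplicial groups are Kan complexes *)

(** Moore's argument, where [sub] stands for the subtraction of a simplicial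
    abelian group: the faces of a simplex are corrected one at a time.
    Subtracting [s_q (d_r w - t_r)], with [q = r] for [r < k] and [q = r - 1] for
    [r > k], makes the [r]-th face right.  The faces below [k] are treated in
    increasing order and then those above [k] in decreasing order: a face which
    is already right is not affected, because the horn condition makes the
    corresponding face of the correction vanish. *)
Lemma simplicial_group_kan (K : sset) (zero : forall m, K m)
    (sub : forall m, K m -> K m -> K m) :
  (forall m (x y : K m), sub m x (sub m x y) = y) ->
  (forall m (x z : K m), sub m x (sub m z z) = x) ->
  (forall m i (x y : K m.+1),
     face i (sub m.+1 x y) = sub m (face i x) (face i y)) ->
  (forall m i (x y : K m),
     degen i (sub m x y) = sub m.+1 (degen i x) (degen i y)) ->
  kan K.
Proof.
move=> subK sub0 faceB degenB [|m] k t tC.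
  (* A horn in an edge has a single face, and a degenerate edge fills it. *)
  exists (degen (inord 0) (t (inord (1 - k)))) => i ik.
  have hk := ltn_ord k; have hi := ltn_ord i.
  have ik' : i != k :> nat by [].
  have -> : inord (1 - k) = i by apply/val_inj; rewrite /= inordK; lia.
  rewrite -[X in face X _](inord_val i).
  have [->|->] : i = 0 :> nat \/ i = 1 :> nat by lia.
    by rewrite face_degen_id.
  by rewrite face_degen_idS.
have hk := ltn_ord k; pose T i := t (inord i).
have {}tC i j : (i < j <= m.+2)%N -> i != k -> j != k ->
    face (inord i) (T j) = face (inord j.-1) (T i).
  move=> ij ik jk; have := tC (inord i) (inord j); rewrite !inordK; [|lia..].
  have neq l : (l <= m.+2)%N -> l != k -> inord l != k.
    by move=> hl; apply: contra => /eqP <-; rewrite inordK.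
  by apply; rewrite ?neq //; lia.
pose fix_face r q (w : K m.+2) :=
  sub _ w (degen (inord q) (sub _ (face (inord r) w) (T r))).
have [w wP] : exists w : K m.+2, forall i, (i < k)%N -> face (inord i) w = T i.
  suff /(_ k (leqnn _)) : forall r, (r <= k)%N -> exists w : K m.+2,
      forall i, (i < r)%N -> face (inord i) w = T i by [].
  elim=> [_|r IHr rk]; first by exists (zero _).
  have [w wP] := IHr (ltnW rk); exists (fix_face r r w) => i; rewrite faceB.
  case: (ltngtP i r) => [ir _|?|-> _]; [|lia|by rewrite face_degen_id ?subK //; lia].
  rewrite wP // face_degen_lt ?faceB; last by lia.
  rewrite face_face ?wP //; last by lia.
  by rewrite (tC i r) ?degenB ?sub0 //; lia.
suff /(_ m.+3) [v vP] : forall r, exists v : K m.+2, forall i, (i <= m.+2)%N ->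
    (i < k)%N || (k < i)%N && (m.+2 < i + r)%N -> face (inord i) v = T i.
  exists v => i ik; have hi := ltn_ord i; rewrite -[X in face X _](inord_val i).
  have ik' : i != k :> nat by [].
  by rewrite vP /T ?inord_val //; lia.
elim=> [|r [v vP]]; first by exists w => i hi hik; apply: wP; lia.
case: (leqP (m.+2 - r) k) => [rk|kr]; first by exists v => i hi hik; apply: vP; lia.
case: (leqP r m.+2) => hr; last by exists v => i hi hik; apply: vP; lia.
pose s := (m.+2 - r)%N; exists (fix_face s s.-1 v) => i hi hik; rewrite faceB.
have sE : s = (m.+2 - r)%N by []; clearbody s.
case: (ltngtP i s) => is_; last first.
- rewrite is_ -{2}(@prednK s) ?face_degen_idS ?subK //; lia.
- rewrite vP //; last by lia.
  rewrite face_degen_gt ?faceB; last by lia.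
  have := @face_face K m s i v; rewrite vP // => [<-|]; [|lia|lia].
  by rewrite (tC s i) ?degenB ?sub0 //; lia.
- rewrite vP //; last by lia.
  rewrite face_degen_lt ?faceB; last by lia.
  rewrite face_face ?vP //; [|lia..].
  by rewrite (tC i s) ?degenB ?sub0 //; lia.
Qed.

(** * The simplicial group of cocycles *)

(** Cochains are functions on sequences of vertices.  The coboundary is the
    usual alternating sum over the omission of one entry, in a recursive form
    that avoids indices; [cobd_enum] recovers the sum. *)
Section Cobd.
Variable A : zmodType.

Fixpoint cobd (T : Type) (f : seq T -> A) (s : seq T) : A :=
  if s is x :: s' then f s' - cobd (fun t => f (x :: t)) s' else 0.

Lemma cobd_cons T (f : seq T -> A) x s :
  cobd f (x :: s) = f s - cobd (fun t => f (x :: t)) s.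
Proof. by []. Qed.

Lemma cobd0 T (s : seq T) : cobd (fun=> 0) s = 0.
Proof. by elim: s => //= x s ->; rewrite subr0. Qed.

Lemma cobdB T (f g : seq T -> A) s :
  cobd (fun t => f t - g t) s = cobd f s - cobd g s.
Proof.
elim: s f g => [|x s IHs] f g /=; first by rewrite subr0.
rewrite (IHs (fun t => f (x :: t)) (fun t => g (x :: t))) !opprB.
by rewrite [X in _ + X = _]addrC addrACA [X in _ + X = _]addrC.
Qed.

Lemma cobd_map T U (h : T -> U) (f : seq U -> A) s :
  cobd (fun t => f (map h t)) s = cobd f (map h s).
Proof. by elim: s f => //= x s IHs f; rewrite -IHs. Qed.

Lemma cobd_enum N T (h : 'I_N.+1 -> T) (f : seq T -> A) :
  cobd f (map h (enum 'I_N.+1)) =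
  \sum_(i < N.+1) f [seq h (lift i k) | k <- enum 'I_N] *~ (-1) ^+ i.
Proof.
elim: N h f => [|N IHN] h f.
  rewrite big_ord_recl big_ord0 addr0 enum_ordSl.
  have -> : enum 'I_0 = [::] by apply/size0nil; rewrite size_enum_ord.
  by rewrite /= subr0.
rewrite enum_ordSl map_cons cobd_cons -map_comp big_ord_recl; congr (_ + _).
rewrite IHN -sumrN; apply: eq_bigr => i _.
rewrite exprS mulN1r mulrNz; congr (- (f _ *~ _)).
rewrite [in RHS]enum_ordSl map_cons; congr (_ :: _).
  by congr h; apply/val_inj.
rewrite -[RHS]map_comp; apply: eq_map => k /=; congr h; apply/val_inj.
by rewrite /= /bump; lia.
Qed.

Definition incr m (s : seq 'I_m) := sorted (fun i j : 'I_m => (i < j)%N) s.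

Lemma incr_cons m (x : 'I_m) s : incr (x :: s) -> incr s.
Proof. exact: path_sorted. Qed.

(** For a weakly increasing sequence with a repetition, the two terms that omit
    one of the equal neighbours cancel, and the others still have a repetition. *)
Lemma cobd_degenerate m (f : seq 'I_m -> A) s :
  (forall t, ~~ incr t -> f t = 0) ->
  sorted (fun i j : 'I_m => (i <= j)%N) s -> ~~ incr s -> cobd f s = 0.
Proof.
elim: s f => //= x s IHs f f0 le_s nincr.
have fx0 t : ~~ incr t -> f (x :: t) = 0.
  by move=> ht; apply: f0; apply: contra ht; apply: incr_cons.
case: (boolP (incr s)) => [incr_s|nincr_s]; last first.
  by rewrite f0 // IHs ?subr0 //; apply: path_sorted le_s.
case: s {IHs} le_s nincr incr_s => //= y s /andP[xy _] nincr incr_s.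
have {nincr xy} -> : x = y.
  apply/val_inj/eqP; rewrite eqn_leq xy leqNgt.
  by apply: contra nincr; rewrite /incr /= => ->.
rewrite opprB addrC subrK -[RHS](cobd0 s); congr (cobd _ s).
by apply/funext => t; apply: f0; rewrite /incr /= ltnn.
Qed.

End Cobd.

Lemma incr_uniq m (s : seq 'I_m) : incr s -> uniq s.
Proof.
by apply: sorted_uniq => [i j k|i]; [apply: ltn_trans|rewrite /= ltnn].
Qed.

Lemma incr_enum m : incr (enum 'I_m).
Proof.
rewrite /incr (_ : sorted _ _ = sorted ltn (map val (enum 'I_m))).
  by rewrite val_enum_ord iota_ltn_sorted.
by rewrite sorted_map.
Qed.

Lemma incr_full m (s : seq 'I_m) : size s = m -> incr s -> s = enum 'I_m.
Proof.
move=> sm incr_s; apply: (irr_sorted_eq _ _ incr_s (incr_enum m)).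
- by move=> i j k; apply: ltn_trans.
- by move=> i; rewrite /= ltnn.
- have [||_ h] := @uniq_min_size _ s (enum 'I_m) (incr_uniq incr_s).
  + by move=> i _; rewrite mem_enum.
  + by rewrite size_enum_ord sm.
  + by [].
Qed.

Lemma incr_size m (s : seq 'I_m) : incr s -> (size s <= m)%N.
Proof.
by move/incr_uniq/card_uniqP => <-; rewrite -[m in (_ <= m)%N]card_ord max_card.
Qed.

Lemma missing_vertex m (s : seq 'I_m) : (size s < m)%N -> exists i, i \notin s.
Proof.
move=> sm; apply: contrapT => h.
have : (size (enum 'I_m) <= size s)%N.
  apply: uniq_leq_size (enum_uniq _) _ => i _.
  by apply/negPn/negP => his; apply: h; exists i.
by rewrite size_enum_ord leqNgt sm.
Qed.

(** Sequences that avoid the vertex [i] live on the [i]-th face. *)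
Lemma avoid_lift m (i : 'I_m.+1) (s : seq 'I_m.+1) :
  i \notin s -> exists t, s = map (lift i) t.
Proof.
elim: s => [|x s IHs]; first by exists [::].
rewrite inE negb_or => /andP[ix /IHs[t ->]].
by have [j -> _] := unlift_some ix; exists (j :: t).
Qed.

Section Model.
Variables (A : zmodType) (n : nat).

(** Vanishing off the increasing sequences of length [n.+1] expresses both the
    degree and the normalization of a cochain. *)
Definition is_cocycle m (f : seq 'I_m.+1 -> A) : Prop :=
  (forall s, ~~ ((size s == n.+1) && incr s) -> f s = 0) /\
  (forall s, size s = n.+2 -> incr s -> cobd f s = 0).

Definition cocycle m := {f : seq 'I_m.+1 -> A | is_cocycle f}.

Lemma cocycle_eq m (x y : cocycle m) : sval x =1 sval y -> x = y.
Proof. by case: x y => [f hf] [g hg] /funext fg; apply: eq_exist. Qed.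

(** Faces and degeneracies are both instances of the pullback along a monotone
    map.  A strictly increasing sequence may become only weakly increasing, which
    [cobd_degenerate] takes care of. *)
Lemma is_cocycle_pull a b (h : 'I_a.+1 -> 'I_b.+1) (f : seq 'I_b.+1 -> A) :
  {homo h : i j / (i <= j)%N} -> is_cocycle f -> is_cocycle (f \o map h).
Proof.
move=> h_homo [f0 fc].
have h_incr s : incr (map h s) -> incr s.
  rewrite /incr sorted_map; apply: sub_sorted => i j /=; rewrite !ltnNge.
  by apply: contra; apply: h_homo.
split=> s.
  move=> hs; apply: f0; rewrite size_map; apply: contra hs => /andP[->] /=.
  exact: h_incr.
move=> ss incr_s; rewrite /comp cobd_map.
case: (boolP (incr (map h s))) => [|nincr]; first by apply: fc; rewrite size_map.
apply: cobd_degenerate => // [t nt|]; first by apply: f0; rewrite negb_and nt orbT.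
rewrite sorted_map; apply: sub_sorted incr_s => i j /= ij.
by apply: h_homo; apply: ltnW.
Qed.

Lemma lift_homo m (i : 'I_m.+2) : {homo @lift m.+2 i : j k / (j <= k)%N}.
Proof. by move=> j k jk; rewrite /= leq_bump2. Qed.

(** The monotone surjection which takes the value [i] twice. *)
Definition collapse m (i : 'I_m.+1) (k : 'I_m.+2) : 'I_m.+1 := inord (unbump i k).

Lemma collapseE m (i : 'I_m.+1) (k : 'I_m.+2) : collapse i k = unbump i k :> nat.
Proof.
have hi := ltn_ord i; have hk := ltn_ord k.
by rewrite inordK // /unbump; lia.
Qed.

Lemma collapse_homo m (i : 'I_m.+1) : {homo collapse i : j k / (j <= k)%N}.
Proof. by move=> j k jk; rewrite !collapseE /unbump; lia. Qed.

Definition cface m (i : 'I_m.+2) (x : cocycle m.+1) : cocycle m :=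
  exist _ _ (is_cocycle_pull (@lift_homo m i) (svalP x)).

Definition cdegen m (i : 'I_m.+1) (x : cocycle m) : cocycle m.+1 :=
  exist _ _ (is_cocycle_pull (@collapse_homo m i) (svalP x)).

Definition cocycle_sset : sset.
Proof.
refine (@SSet cocycle cface cdegen _ _ _ _ _ _).
- move=> m i j x ij; apply: cocycle_eq => s /=; rewrite -!map_comp.
  congr (sval x _); apply: eq_map => k; apply/val_inj => /=.
  by rewrite !inordK /bump; lia.
- move=> m i j x ij; apply: cocycle_eq => s /=; rewrite -!map_comp.
  congr (sval x _); apply: eq_map => k; apply/val_inj => /=.
  by rewrite !collapseE !inordK /unbump; lia.
- move=> m i j x ij; apply: cocycle_eq => s /=; rewrite -!map_comp.
  congr (sval x _); apply: eq_map => k; apply/val_inj => /=.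
  by rewrite collapseE /= collapseE !inordK /unbump /bump; lia.
- move=> m j x jm; apply: cocycle_eq => s /=; rewrite -!map_comp.
  congr (sval x _); rewrite -[RHS]map_id; apply: eq_map => k; apply/val_inj => /=.
  by rewrite collapseE /= !inordK /unbump /bump; lia.
- move=> m j x jm; apply: cocycle_eq => s /=; rewrite -!map_comp.
  congr (sval x _); rewrite -[RHS]map_id; apply: eq_map => k; apply/val_inj => /=.
  by rewrite collapseE /= !inordK /unbump /bump; lia.
- move=> m i j x ij; apply: cocycle_eq => s /=; rewrite -!map_comp.
  congr (sval x _); apply: eq_map => k; apply/val_inj => /=.
  by rewrite collapseE /= collapseE !inordK /unbump /bump; lia.
Defined.

Lemma is_cocycle0 m : is_cocycle (fun _ : seq 'I_m.+1 => 0).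
Proof. by split=> // s _ _; apply: cobd0. Qed.

Lemma is_cocycleB m (x y : cocycle m) : is_cocycle (fun s => sval x s - sval y s).
Proof.
case: x y => [f [f0 fc]] [g [g0 gc]]; split=> s /=.
  by move=> hs; rewrite f0 // g0 // subr0.
by move=> ss incr_s; rewrite cobdB fc // gc // subr0.
Qed.

Definition cocycle0 m : cocycle m := exist _ _ (is_cocycle0 m).
Definition cocycleB m (x y : cocycle m) : cocycle m := exist _ _ (is_cocycleB x y).

Lemma cocycle_kan : kan cocycle_sset.
Proof.
apply: (@simplicial_group_kan cocycle_sset cocycle0 cocycleB).
- by move=> m x y; apply: cocycle_eq => s /=; rewrite opprB addrC subrK.
- by move=> m x z; apply: cocycle_eq => s /=; rewrite subrr subr0.
- by move=> m i x y; apply: cocycle_eq.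
- by move=> m i x y; apply: cocycle_eq.
Qed.

Definition cocycle_pkan : pkan := @PKan cocycle_sset (cocycle0 0) cocycle_kan.
Local Notation H := cocycle_pkan.

Lemma cocycle_low m (x y : H m) : (m < n)%N -> x = y.
Proof.
move=> mn; apply: cocycle_eq => s.
have hs : ~~ ((size s == n.+1) && incr s).
  by apply/negP => /andP[/eqP ss /incr_size]; rewrite ss; lia.
by case: x y => [f [f0 _]] [g [g0 _]] /=; rewrite f0 // g0.
Qed.

(** For [m > n], a set of [n.+1] vertices misses a vertex, so the value of the
    cocycle on it is read off from a face. *)
Lemma cocycle_same_boundary m (x y : H m) :
  m != n -> same_boundary x y -> x = y.
Proof.
case: (ltngtP m n) => // mn _; first by move=> _; apply: cocycle_low.
case: m x y mn => // m x y mn xy; apply: cocycle_eq => s.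
case: (boolP ((size s == n.+1) && incr s)) => [/andP[/eqP ss incr_s]|hs].
  have [|i /avoid_lift[t ->]] := @missing_vertex _ s; first by rewrite ss.
  by have := congr1 (fun z => sval z t) (xy i).
by case: x y xy => [f [f0 _]] [g [g0 _]] _ /=; rewrite f0 // g0.
Qed.

Definition top_value (x : H n) : A := sval x (enum 'I_n.+1).

(** In dimension [n] there is a single nondegenerate [n]-dimensional face. *)
Lemma top_value_inj : injective top_value.
Proof.
move=> x y xy; apply: cocycle_eq => s.
case: (boolP ((size s == n.+1) && incr s)) => [/andP[/eqP ss incr_s]|hs].
  by rewrite (incr_full ss incr_s).
by case: x y xy => [f [f0 _]] [g [g0 _]] _ /=; rewrite f0 // g0.
Qed.

Lemma top_value_surj a : exists x, top_value x = a.
Proof.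
have fP : is_cocycle (fun s : seq 'I_n.+1 => if s == enum 'I_n.+1 then a else 0).
  split=> s.
    by move=> hs; case: ifP => // /eqP e; rewrite e size_enum_ord eqxx incr_enum in hs.
  by move=> ss /incr_size; rewrite ss ltnn.
by exists (exist _ _ fP); rewrite /top_value /= eqxx.
Qed.

(** The cocycle condition of the filler on its full sequence of vertices. *)
Lemma top_value_filled (t : 'I_n.+2 -> H n) : filled t ->
  \sum_i top_value (t i) *~ (-1) ^+ i = 0.
Proof.
case=> w wP; case: (svalP w) => _ /(_ (enum 'I_n.+2)).
rewrite size_enum_ord => /(_ erefl (incr_enum _)) w0.
rewrite -[RHS]w0 -[enum _ in RHS]map_id cobd_enum.
by apply: eq_bigr => i _; rewrite -wP.
Qed.

End Model.

(** A homotopy between simplices of dimension [p.+1], and a product of such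
    simplices, are tuples of which at most the last two, resp. three, entries
    have a nonzero value: the alternating sum relation for these tuples says that
    homotopic simplices have equal values, and that values add up. *)
Lemma cocycle_em (A : zmodType) p :
  minimal (cocycle_pkan A p.+1) /\
  eilenberg_maclane A p.+1 (cocycle_pkan A p.+1).
Proof.
set H := cocycle_pkan A p.+1; pose v := @top_value A p.+1.
have low m (x : H m) : (m < p.+1)%N -> x = base H m.
  by move=> mp; apply: cocycle_low.
have v0 : v (base H p.+1) = 0.
  rewrite /v /top_value /=; case: (base H p) => f [f0 fc] /=.
  apply: f0; rewrite size_map size_enum_ord eqxx /=.
  by apply/negP => /incr_size; rewrite size_map size_enum_ord ltnn.
have minH : minimal H.
  move=> m x y xy [_ fxy].
  case: (eqVneq m p.+1) => mp; last exact: cocycle_same_boundary xy.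
  subst m; apply: top_value_inj.
  have := top_value_filled fxy; rewrite big_ord_recr big_ord_recr big1 => [|i _].
    rewrite /homotopy_tuple /= ltnn eqxx ltnNge leqnSn /= gtn_eqF // add0r.
    rewrite (exprS _ p.+1) mulN1r mulrNz -mulrzBl => /mulrz_sign_eq0/eqP.
    by rewrite subr_eq0 => /eqP.
  rewrite /homotopy_tuple (_ : (widen_ord _ _ < p.+1)%N); last exact: (ltn_ord i).
  by rewrite /degen_face (low p (face _ _)) // degen_base -/(v _) v0 mul0rz.
split=> //; split; last first.
  move=> k kp a; have [[x sx] ->] := pi_classE a; congr pi_class; apply: eq_exist.
  apply: cocycle_same_boundary => //.
  by case: k x sx {a kp} => // k x sx i; rewrite sx face_base.
pose f (C : Defs.pi H p.+1) := v (sval (sval (cid (svalP C)))).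
have sph (x : H p.+1) : is_sphere x by move=> i; apply: low.
have fE (x : sphere H p.+1) : f (pi_class x) = v (sval x).
  rewrite /f; case: cid => y /= xy; congr v; symmetry; apply: minH.
    by move=> i; rewrite (svalP x) (svalP y).
  by apply/pi_classP/eq_exist.
exists f; split.
  have /choice[g gP] (a : A) : exists C, f C = a.
    have [x <-] := top_value_surj p.+1 a.
    by exists (pi_class (exist _ x (sph x))); rewrite fE.
  exists g => // C; have [x xE] := pi_classE C; have [y yE] := pi_classE (g (f C)).
  rewrite yE xE; congr pi_class; have := gP (f C).
  rewrite yE [in RHS]xE !fE => /top_value_inj.
  by case: x y {xE yE} => x sx [y sy] /= yx; apply: eq_exist.
move=> a b; have [x ->] := pi_classE a; have [y ->] := pi_classE b.
have [z fz] := pi_mul_ex x y isT.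
rewrite (pi_mulE _ fz) // !fE.
have := top_value_filled fz.
rewrite big_ord_recr big_ord_recr big_ord_recr big1 => [|i _].
  rewrite /mul_tuple /= ltnn eqxx ltnNge leqnSn /= gtn_eqF // add0r.
  have -> : (p.+3 < p.+1)%N = false by lia.
  have -> : (p.+3 == p.+1) = false by lia.
  rewrite (exprS _ p.+1) (exprS _ p) !mulN1r opprK mulrNz -mulrzBl -mulrzDl.
  move=> /mulrz_sign_eq0/eqP; rewrite -!/(v _) addrAC subr_eq0 => /eqP <-.
  by rewrite addrC.
by rewrite /mul_tuple (_ : (_ < _)%N); [rewrite -/(v _) v0 mul0rz|exact: (ltn_ord i)].
Qed.

Local Close Scope ring_scope.

(** * Existence and uniqueness *)

Theorem mainTheorem7 (n : nat) (n_gt0 : 0 < n) (A : zmodType) :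
  (exists K : pkan, minimal K /\ eilenberg_maclane A n K) /\
  (forall K L : pkan,
     minimal K -> eilenberg_maclane A n K ->
     minimal L -> eilenberg_maclane A n L ->
     pkan_isomorphic K L).
Proof.
case: n n_gt0 => // p _; split.
  by exists (cocycle_pkan A p.+1); apply: cocycle_em.
move=> K L minK emK minL emL.
have [phiK labK] := minimal_em_labelling minK emK.
have [phiL labL] := minimal_em_labelling minL emL.
exact: em_labelling_iso labK labL.
Qed.
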